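(* Let $0<p_1<1$ and let $|\Psi_a\rangle=\sqrt a\,|00\rangle+\sqrt{1-a}\,|11\rangle$ with $\frac12<a<1$ and concurrence $C:=C(|\Psi_a\rangle)=2\sqrt{a(1-a)}=p_1$. Let $$\gamma(p_1)=\frac{1+\sqrt{1-p_1^2}-\sqrt{3p_1^2-2+2\sqrt{1-p_1^2}}}{2+2\sqrt{1-p_1^2}},$$ and let $\Lambda^*_{nu}$ be the non-unital qubit channel with Kraus operators (in the basis $\{|0\rangle,|1\rangle\}$) $$K_0=\begin{pmatrix}\sqrt{1-\gamma(p_1)}&0\\0&1\end{pmatrix},\qquad K_1=\begin{pmatrix}0&0\\\sqrt{\gamma(p_1)}&0\end{pmatrix}.$$ Then the final shared state $\rho^f=(\mathbf I\otimes\Lambda^*_{nu})(|\Psi_a\rangle\langle\Psi_a|)$ satisfies $$F_{\rho^f}=\frac{3-\sqrt{1-C^2}+\sqrt{3C^2-2+2\sqrt{1-C^2}}}{4},\qquad \Delta_{\rho^f}=0,$$ for all $C\in(0,1)$, and $F_{\rho^f}>\frac23$ whenever $$\sqrt{\tfrac23\,(4+\sqrt3)\bigl(1-\tfrac16(4+\sqrt3)\bigr)}<C<1.$$ Consequently, for every such $C$ the final state is useful for universal quantum teleportation (UQT).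
   Context: A qubit channel is a completely positive trace-preserving linear map $\Lambda(\chi)=\sum_iK_i\chi K_i^\dagger$ with $\sum_iK_i^\dagger K_i=\mathbf I_2$; it is non-unital if $\Lambda(\mathbf I_2)\ne\mathbf I_2$. Fidelity quantities. For a two-qubit density matrix $\rho$ let $T_\rho$ be the real $3\times3$ matrix with entries $T_{ij}=\mathrm{Tr}(\rho\,\sigma_i\otimes\sigma_j)$ ($\sigma_1,\sigma_2,\sigma_3$ the Pauli matrices). By local unitaries $\rho$ can be brought to a canonical form $\rho_C$ with diagonal correlation matrix $\mathrm{diag}(\tau_1,\tau_2,\tau_3)$, $\tau_k=\lambda_k|t_{kk}|$, $\lambda_k\in\{\pm1\}$, where $|t_{11}|,|t_{22}|,|t_{33}|$ are the singular values of $T_\rho$; if $\det T_\rho\le 0$ all $\lambda_k=-1$, and if $\det T_\rho>0$ the $\lambda_k$ equal $-1$ for the two largest $|t_{kk}|$ and $+1$ for the smallest. The maximal average fidelity $F_\rho$ is the average teleportation fidelity (over uniformly distributed pure qubit inputs, standard teleportation protocol, maximized over local unitaries), attained by $\rho_C$, and the fidelity deviation $\Delta_\rho$ is the standard deviation over inputs of the fidelity when $\rho_C$ is used; explicitly $F_\rho=\frac12\bigl(1-\frac13\sum_k\tau_k\bigr)$ and $\Delta_\rho=\frac{1}{3\sqrt{10}}\sqrt{\sum_{i<j}(\tau_i-\tau_j)^2}$. The state $\rho$ is useful for UQT if $F_\rho>\frac23$ and $\Delta_\rho=0$. *)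

(* Defs.v *)
From HB Require Import structures.
From mathcomp Require Import all_boot all_order all_algebra.
From mathcomp Require Import all_classical all_reals all_analysis.
From mathcomp Require Export spectral complex mxtens.

Set Implicit Arguments.
Unset Strict Implicit.
Unset Printing Implicit Defensive.

Import Order.TTheory GRing.Theory Num.Theory.
Import numFieldNormedType.Exports.

Local Open Scope classical_set_scope.
Local Open Scope ring_scope.
Local Open Scope complex_scope.
Local Open Scope sesquilinear_scope.

(* Vectors and operators of (C^2)^{(x) n} have dimension 2 * (2 * ...), with the
   tensor product [*t]; the k-th basis vector of C^m (x) C^n is
   |k %/ n> (x) |k %% n>. *)

Section Qubits.
Variable R : realType.
Local Notation C := R[i].

Definition mx2 (a b c d : C) : 'M[C]_2 :=
  \matrix_(i, j) if i == 0 then (if j == 0 then a else b)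
                 else (if j == 0 then c else d).

(* sigma_0 = I, then sigma_x, sigma_y, sigma_z *)
Definition pauli (k : nat) : 'M[C]_2 :=
  match k with
  | 0 => 1%:M
  | 1 => mx2 0 1 1 0
  | 2 => mx2 0 (- 'i) 'i 0
  | _ => mx2 1 0 0 (- 1)
  end.

Definition ket (i : 'I_2) : 'cV[C]_2 := delta_mx i 0.

Definition ket2 (i j : 'I_2) : 'cV[C]_(2 * 2) := ket i *t ket j.

Definition projector n (psi : 'cV[C]_n) : 'M[C]_n := psi *m psi^t*.

Definition kraus_map n (K : 'I_n -> 'M[C]_2) (chi : 'M[C]_2) : 'M[C]_2 :=
  \sum_i K i *m chi *m (K i)^t*.

Definition qubit_channel (L : 'M[C]_2 -> 'M[C]_2) : Prop :=
  exists n (K : 'I_n -> 'M[C]_2),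
    \sum_i (K i)^t* *m K i = 1%:M /\ forall chi, L chi = kraus_map K chi.

Definition non_unital (L : 'M[C]_2 -> 'M[C]_2) : Prop := L 1%:M <> 1%:M.

(* (I (x) L)(rho) = sum_(i, j) |i><j| (x) L(<i|rho|j>), the partial matrix
   elements being taken on the first qubit *)
Definition id_tens (L : 'M[C]_2 -> 'M[C]_2) (rho : 'M[C]_(2 * 2)) :
    'M[C]_(2 * 2) :=
  \sum_(i < 2) \sum_(j < 2)
    delta_mx i j *t
      L (\matrix_(k, l) rho (mxtens_index (i, k)) (mxtens_index (j, l))).

(* |<psi| sigma_y (x) sigma_y |psi^*>| *)
Definition concurrence (psi : 'cV[C]_(2 * 2)) : R :=
  complex.Re
    `|(psi^t* *m (pauli 2 *t pauli 2) *m map_mx Num.conj psi) 0 0|.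

(* the traces are real when rho is Hermitian *)
Definition corr (rho : 'M[C]_(2 * 2)) : 'M[R]_3 :=
  \matrix_(i, j) complex.Re (\tr (rho *m (pauli i.+1 *t pauli j.+1))).

Definition local_conj (U V : 'M[C]_2) (rho : 'M[C]_(2 * 2)) : 'M[C]_(2 * 2) :=
  (U *t V) *m rho *m (U *t V)^t*.

(* Bell basis (sigma_k (x) I)|Psi^->, |Psi^-> = (|01> - |10>) / sqrt 2 *)
Definition bell (k : 'I_4) : 'cV[C]_(2 * 2) :=
  (pauli k *t 1%:M) *m ((Num.sqrt 2)^-1%:C *: (ket2 0 1 - ket2 1 0)).

(* Bob's state after the outcome k of the Bell measurement on the input qubit
   and on Alice's half of rho; it is left unnormalised, its trace being the
   probability of the outcome. *)
Definition bell_outcome (psi : 'cV[C]_2) (rho : 'M[C]_(2 * 2)) (k : 'I_4) :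
    'M[C]_2 :=
  let V : 'M[C]_(2, 2 * (2 * 2)) := (bell k)^t* *t (1%:M : 'M[C]_2) in
  V *m (projector psi *t rho) *m V^t*.

(* Bob corrects by sigma_k, so that the protocol is exact for the singlet.
   For a general rho this is (1 - sum_k T_kk n_k^2) / 2, with T = corr rho and
   n the Bloch vector of the input. *)
Definition teleport_fidelity (rho : 'M[C]_(2 * 2)) (psi : 'cV[C]_2) : R :=
  complex.Re (\sum_(k < 4)
    (psi^t* *m (pauli k *m bell_outcome psi rho k *m (pauli k)^t*) *m psi) 0 0).

Definition bloch_ket (theta phi : R) : 'cV[C]_2 :=
  (cos (theta / 2))%:C *: ket 0 +
  ((cos phi +i* sin phi) * (sin (theta / 2))%:C) *: ket 1.

(* average over uniformly distributed pure qubit inputs *)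
Definition input_average (g : 'cV[C]_2 -> R) : R :=
  (4 * pi)^-1 *
  \int[lebesgue_measure]_(theta in `[0, pi])
    (\int[lebesgue_measure]_(phi in `[0, 2 * pi])
       (g (bloch_ket theta phi) * sin theta)).

Definition average_fidelity (rho : 'M[C]_(2 * 2)) : R :=
  input_average (teleport_fidelity rho).

Definition fidelity_stddev (rho : 'M[C]_(2 * 2)) : R :=
  Num.sqrt (input_average
    (fun psi => (teleport_fidelity rho psi - average_fidelity rho) ^+ 2)).

(* The supremum is attained at the canonical forms below, where it is
   (1 - (sum_k tau_k) / 3) / 2 with tau_k = lambda_k t_k. *)
Definition max_average_fidelity (rho : 'M[C]_(2 * 2)) : R :=
  sup [set x | exists U V : 'M[C]_2, [/\ U \is unitarymx, V \is unitarymx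
                 & x = average_fidelity (local_conj U V rho)]].

(* t lists the singular values of T with multiplicity, in some order *)
Definition singular_values (T : 'M[R]_3) (t : 'I_3 -> R) : Prop :=
  (forall k, 0 <= t k) /\
  char_poly (T^T *m T) = \prod_k ('X - (t k ^+ 2)%:P).

Definition canonical_signs (T : 'M[R]_3) (t lambda : 'I_3 -> R) : Prop :=
  (\det T <= 0 -> forall k, lambda k = - 1) /\
  (0 < \det T -> exists m, [/\ forall k, t m <= t k, lambda m = 1
                              & forall k, k != m -> lambda k = - 1]).

Definition is_canonical_form (rho rhoC : 'M[C]_(2 * 2)) : Prop :=
  (exists U V : 'M[C]_2, [/\ U \is unitarymx, V \is unitarymx
                           & rhoC = local_conj U V rho]) /\
  exists t lambda : 'I_3 -> R,
    [/\ singular_values (corr rho) t, canonical_signs (corr rho) t lambda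
      & corr rhoC = diag_mx (\row_k (lambda k * t k))].

(* A canonical form is not unique, but two of them have the same tau_k up to a
   permutation of the axes, hence the same fidelity_stddev, namely
   sqrt (sum_(i < j) (tau_i - tau_j)^2) / (3 sqrt 10). *)
Definition canonical_form (rho : 'M[C]_(2 * 2)) : 'M[C]_(2 * 2) :=
  xget rho [set rhoC | is_canonical_form rho rhoC].

Definition fidelity_deviation (rho : 'M[C]_(2 * 2)) : R :=
  fidelity_stddev (canonical_form rho).

Definition useful_for_UQT (rho : 'M[C]_(2 * 2)) : Prop :=
  2 / 3 < max_average_fidelity rho /\ fidelity_deviation rho = 0.

Definition Psi (a : R) : 'cV[C]_(2 * 2) :=
  (Num.sqrt a)%:C *: ket2 0 0 + (Num.sqrt (1 - a))%:C *: ket2 1 1.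

Definition gamma (p : R) : R :=
  (1 + Num.sqrt (1 - p ^+ 2)
     - Num.sqrt (3 * p ^+ 2 - 2 + 2 * Num.sqrt (1 - p ^+ 2)))
  / (2 + 2 * Num.sqrt (1 - p ^+ 2)).

Definition Kraus_nu (g : R) (k : 'I_2) : 'M[C]_2 :=
  if k == 0 then mx2 (Num.sqrt (1 - g))%:C 0 0 1
  else mx2 0 0 (Num.sqrt g)%:C 0.

Definition Lambda_nu (p : R) : 'M[C]_2 -> 'M[C]_2 :=
  kraus_map (Kraus_nu (gamma p)).

End Qubits.

(* Main.v *)
(* Write w = 2 a - 1 = sqrt (1 - C^2) and q = sqrt ((1 - w) (1 + 3 w)). The damping
   keeps the correlation matrix diagonal, equal to diag (s, - s, 1 - 2 a gamma) with
   s = C sqrt (1 - gamma), and gamma is chosen so that s = 1 - 2 a gamma =: t; then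
   t = (1 - w + q) / 2.
   Averaging the teleportation fidelity (1 - sum_k T_kk n_k^2) / 2 over the sphere
   gives (1 - tr T / 3) / 2. Local unitaries turn each sigma_k (x) sigma_k into some
   (n . sigma) (x) (m . sigma) with unit vectors n, m, so every T_kk is at least - t,
   and sigma_y (x) I turns T into - t I: hence F = (1 + t) / 2. Every canonical form
   has T = - t I, for which the fidelity does not depend on the input. *)

Require Import Defs.
From mathcomp Require Import all_boot all_order all_algebra.
From mathcomp Require Import all_classical all_reals all_analysis.
From mathcomp Require Import ring lra.
Import Order.TTheory GRing.Theory Num.Theory.
Import numFieldNormedType.Exports.
Local Open Scope ring_scope.

Set Implicit Arguments.
Unset Strict Implicit.
Unset Printing Implicit Defensive.

(** * Integrals over the two angles of the Bloch sphere *)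

Section Integrals.
Local Open Scope classical_set_scope.
Variable R : realType.
Local Notation mu := (@lebesgue_measure R).

(** Derivability on the whole line supplies every continuity condition of the fundamental theorem,
    so only an antiderivative remains to be given. *)
Lemma Rintegral_FTC2 (f F : R -> R) (a b : R) : a < b ->
  (forall x : R, derivable f x 1) -> (forall x : R, is_derive x 1 F (f x)) ->
  \int[mu]_(x in `[a, b]) f x = F b - F a.
Proof.
move=> ab df dF.
have cont (g : R -> R) : (forall x : R, derivable g x 1) -> continuous g.
  by move=> dg x; apply/differentiable_continuous/derivable1_diffP/dg.
have dF1 x : derivable F x 1 by apply: ex_derive.
rewrite /Rintegral (@continuous_FTC2 R f F a b) //.
- by apply: continuous_subspaceT; exact: cont.
- split; first by move=> x _; exact: dF1.
  + by apply: cvg_at_right_filter; exact: cont.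
  + by apply: cvg_at_left_filter; exact: cont.
- by move=> x _; rewrite derive1E; apply: derive_val.
Qed.

Lemma Rintegral_cos2_sin2 (A B D : R) :
  \int[mu]_(x in `[0, 2 * pi]) (A + B * cos x ^+ 2 + D * sin x ^+ 2)
  = 2 * pi * A + pi * B + pi * D.
Proof.
have pi0 : 0 < 2 * pi :> R by rewrite mulr_gt0 ?pi_gt0.
(* [x + sin x * cos x] and [x - sin x * cos x] have derivatives [2 * cos x ^+ 2] and
   [2 * sin x ^+ 2]. *)
pose F (x : R) := A * x + B / 2 * (x + sin x * cos x) + D / 2 * (x - sin x * cos x).
have dF (x : R) : is_derive x 1 F (A + B * cos x ^+ 2 + D * sin x ^+ 2).
  rewrite /F; apply: is_derive_eq.
  rewrite /GRing.scale /=.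
  have h : cos x ^+ 2 = 1 - sin x ^+ 2 by rewrite -(cos2Dsin2 x) addrK.
  by rewrite -(expr2 (cos x)) h; field.
rewrite (Rintegral_FTC2 pi0 _ dF); last by move=> x; apply: ex_derive.
by rewrite /F [2 * pi]mulr_natl sin0 sin2pi !mul0r; field.
Qed.

Lemma Rintegral_cos2_sin (A B : R) :
  \int[mu]_(x in `[0, pi]) ((A + B * cos x ^+ 2) * sin x)
  = 2 * A + 2 / 3 * B.
Proof.
pose F (x : R) := - (A * cos x) - B / 3 * cos x ^+ 3.
have dF (x : R) : is_derive x 1 F ((A + B * cos x ^+ 2) * sin x).
  rewrite /F; apply: is_derive_eq.
  by rewrite /GRing.scale /=; field.
rewrite (Rintegral_FTC2 (pi_gt0 R) _ dF); last by move=> x; apply: ex_derive.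
by rewrite /F cospi cos0; field.
Qed.

End Integrals.

(** * Sums and indices of tensor products *)

Lemma sum_tens (V : nmodType) m n (F : 'I_(m * n) -> V) :
  \sum_k F k = \sum_i \sum_j F (mxtens_index (i, j)).
Proof.
rewrite pair_bigA /= (reindex (@mxtens_index m n)) /=; last first.
  by exists (@mxtens_unindex m n) => k _; rewrite ?mxtens_indexK ?mxtens_unindexK.
by apply: eq_bigr => -[].
Qed.

Lemma sum_ord2 (V : nmodType) (F : 'I_2 -> V) : \sum_i F i = F 0 + F 1.
Proof.
by rewrite big_ord_recl big_ord1; congr (F _ + F _); apply: val_inj.
Qed.

(** The Bell measurement groups the input with Alice's qubit, while [projector psi *t rho] groups
    Alice's qubit with Bob's; both nestings number the basis alike. *)
Lemma mxtens_index_assoc (j l m : 'I_2) :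
  mxtens_index (j, mxtens_index (l, m)) =
  mxtens_index (mxtens_index (j, l), m) :> 'I_(2 * (2 * 2)).
Proof. by apply: val_inj => /=; rewrite mulnDl addnA -mulnA. Qed.

(** * Outcomes of the Bell measurement in coordinates *)

Section Qubits.
Local Open Scope classical_set_scope.
Local Open Scope complex_scope.
Local Open Scope sesquilinear_scope.
Variable R : realType.
Local Notation C := R[i].
Local Notation cj := (@Num.conj (R[i] : numClosedFieldType)).
Local Notation elt rho ij kl := (rho (mxtens_index ij) (mxtens_index kl)).
Implicit Types (rho : 'M[C]_(2 * 2)) (U V H : 'M[C]_2).

Lemma mx2E (a b c d : C) (i j : 'I_2) :
  mx2 a b c d i j = if i == 0 then (if j == 0 then a else b)
                 else (if j == 0 then c else d).
Proof. by rewrite mxE. Qed.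

Lemma ket2E (i j l m : 'I_2) :
  ket2 R i j (mxtens_index (l, m)) 0 = (l == i)%:R * (m == j)%:R.
Proof.
have := tensmxE (ket R i) (ket R j) l m 0 0.
by rewrite !mxE !eqxx !andbT => <-; rewrite /ket2; congr (_ _ _); apply: val_inj.
Qed.

Lemma bellE (k : 'I_4) (l m : 'I_2) :
  bell R k (mxtens_index (l, m)) 0 =
  (Num.sqrt 2)^-1%:C *
    (pauli R k l 0 * (m == 1)%:R - pauli R k l 1 * (m == 0)%:R).
Proof.
rewrite mxE sum_tens !sum_ord2 !tensmxE.
rewrite [_ *: _]lock !mxE -lock.
have e x y : ((Num.sqrt 2)^-1%:C *: (ket2 R 0 1 - ket2 R 1 0)) (mxtens_index (x, y)) 0
  = (Num.sqrt 2)^-1%:C * ((x == 0)%:R * (y == 1)%:R - (x == 1)%:R * (y == 0)%:R).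
  by rewrite mxE [X in _ * X]mxE [X in _ + X]mxE !ket2E.
rewrite !e /=.
by case: m => [[|[|m]]] //= hm; rewrite ?eqxx /=; ring.
Qed.

Lemma bell_outcomeE (psi : 'cV[C]_2) rho (k : 'I_4) (m m' : 'I_2) :
  bell_outcome psi rho k m m' =
  \sum_(j' < 2) \sum_(l' < 2)
    (\sum_(j < 2) \sum_(l < 2)
       cj (bell R k (mxtens_index (j, l)) 0) * (psi j 0 * cj (psi j' 0)) *
       elt rho (l, m) (l', m')) *
    bell R k (mxtens_index (j', l')) 0.
Proof.
have z (x : 'I_2) : (x : 'I_(1 * 2)) = mxtens_index ((0 : 'I_1), x) by apply: val_inj.
pose V := (bell R k)^t* *t (1%:M : 'M[C]_2).
have V0 (x y u w : 'I_2) : V x (mxtens_index (y, mxtens_index (u, w))) =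
    cj (bell R k (mxtens_index (y, u)) 0) * (x == w)%:R.
  by rewrite /V mxtens_index_assoc (z x) tensmxE !mxE.
have V1 (x y u w : 'I_2) : V^t* (mxtens_index (y, mxtens_index (u, w))) x =
    bell R k (mxtens_index (y, u)) 0 * (x == w)%:R.
  rewrite 2!mxE V0 rmorphM /= conjCK; congr (_ * _).
  exact: conjc_nat.
rewrite /V in V0 V1; rewrite /bell_outcome mxE sum_tens; apply: eq_bigr => j' _.
rewrite sum_tens; apply: eq_bigr => l' _.
(* The identity factor on Bob's qubit kills every index but [m']. *)
rewrite (bigD1 m') //= big1 ?addr0; last first.
  by move=> i /negPf ne; rewrite V1 eq_sym ne !mulr0.
rewrite V1 eqxx mulr1; congr (_ * _).
rewrite mxE sum_tens; apply: eq_bigr => j _.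
rewrite sum_tens; apply: eq_bigr => l _.
rewrite (bigD1 m) //= big1 ?addr0; last first.
  by move=> i /negPf ne; rewrite V0 eq_sym ne !mulr0 mul0r.
rewrite V0 eqxx mulr1 tensmxE mulrA; congr (_ * _ * _).
by rewrite !mxE big_ord1 !mxE.
Qed.

Lemma qformE (psi : 'cV[C]_2) (M : 'M[C]_2) :
  (psi^t* *m M *m psi) 0 0 =
  cj (psi 0 0) * M 0 0 * psi 0 0 + cj (psi 0 0) * M 0 1 * psi 1 0
  + cj (psi 1 0) * M 1 0 * psi 0 0 + cj (psi 1 0) * M 1 1 * psi 1 0.
Proof. by rewrite mxE sum_ord2 !mxE !sum_ord2 !mxE; ring. Qed.

Lemma mulmx2E (M N : 'M[C]_2) i j : (M *m N) i j = M i 0 * N 0 j + M i 1 * N 1 j.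
Proof. by rewrite mxE sum_ord2. Qed.

Lemma mxtrace_tensE rho (A B : 'M[C]_2) :
  \tr (rho *m (A *t B)) = \sum_i \sum_j \sum_k \sum_l
     elt rho (i, j) (k, l) * (A k i * B l j).
Proof.
rewrite /mxtrace sum_tens; apply: eq_bigr => i _; apply: eq_bigr => j _.
rewrite mxE sum_tens; apply: eq_bigr => k _; apply: eq_bigr => l _.
by rewrite tensmxE.
Qed.

Lemma mxtraceE rho : \tr rho = \sum_i \sum_j elt rho (i, j) (i, j).
Proof. exact: sum_tens. Qed.

Lemma adjE m n (M : 'M[C]_(m, n)) i j : (M^t*) i j = cj (M j i).
Proof. by rewrite !mxE. Qed.

(** * Teleportation fidelity as a sum of overlaps *)

Definition alice_amp (psi : 'cV[C]_2) (k : 'I_4) (l : 'I_2) : C :=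
  \sum_j bell R k (mxtens_index (j, l)) 0 * cj (psi j 0).

(** [alice_amp psi k l] is the amplitude [<psi, l|bell k>]: for the input [psi], the outcome [k]
    contracts Alice's half of [rho] with this vector. *)
Lemma bell_outcome_amp psi rho k m m' :
  bell_outcome psi rho k m m' = \sum_l \sum_l'
    cj (alice_amp psi k l) * elt rho (l, m) (l', m') *
    alice_amp psi k l'.
Proof.
rewrite bell_outcomeE /alice_amp !sum_ord2 !rmorphD !rmorphM /= !conjCK.
by ring.
Qed.

(** The vector [(cj q, - cj p)] is orthogonal to [(p, q)], hence antipodal to it on the Bloch
    sphere. *)
Definition antipode (p q : C) (l : 'I_2) : C := if l == 0 then cj q else - cj p.
Definition spin_amp (p q : C) (l : 'I_2) : C := if l == 0 then p else q.

(** Expectation of [rho] in the product of the antipodal vector, on Alice's side, and [(p, q)], on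
    Bob's. *)
Definition overlap rho (p q : C) :=
  \sum_l \sum_m \sum_l' \sum_m' elt rho (l, m) (l', m') *
    (cj (antipode p q l * spin_amp p q m) * (antipode p q l' * spin_amp p q m')).

Lemma inv_sqrt2_sq : ((Num.sqrt 2 : R)^-1%:C) * ((Num.sqrt 2 : R)^-1%:C) = 2^-1.
Proof.
by rewrite -rmorphM /= -invfM -expr2 sqr_sqrtr // fmorphV /= rmorphMn.
Qed.

Lemma conj_real_complex (x : R) : cj (x%:C) = x%:C.
Proof. exact: conjc_real. Qed.

Lemma ii : ('i : C) * 'i = -1. Proof. by rewrite -expr2 sqr_i. Qed.
Lemma conj_i : cj ('i : C) = - 'i. Proof. by apply/eqP; rewrite eq_complex /= oppr0 !eqxx. Qed.

Lemma conjM (x y : C) : cj (x * y) = cj x * cj y. Proof. exact: rmorphM. Qed.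
Lemma conjD (x y : C) : cj (x + y) = cj x + cj y. Proof. exact: rmorphD. Qed.
Lemma conjN (x : C) : cj (- x) = - cj x. Proof. exact: rmorphN. Qed.

Definition conjE := (conjM, conjD, conjN, conj_real_complex).

Lemma conjK (x : C) : cj (cj x) = x. Proof. exact: conjCK. Qed.

Lemma pauli_herm k : (pauli R k)^t* = pauli R k.
Proof.
apply/matrixP => i j; rewrite adjE.
case: k => [|[|[|k]]] /=; rewrite ?mx2E ?mxE.
- by rewrite eq_sym; exact: conjc_nat.
- by case: ifP; case: ifP => _ _ ; rewrite ?conjC0 ?conjC1.
- by case: ifP; case: ifP => _ _ ; rewrite ?conjC0 ?conjN ?conj_i ?opprK.
- by case: ifP; case: ifP => _ _ ; rewrite ?conjC0 ?conjN ?conjC1.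
Qed.

(** Being Hermitian, [pauli R k] can be moved onto [psi]; contracting one half of the singlet with a
    vector leaves the orthogonal vector. *)
Lemma alice_ampE (psi : 'cV[C]_2) (k : 'I_4) (l : 'I_2) :
  alice_amp psi k l = - ((Num.sqrt 2)^-1%:C *
    antipode ((pauli R k *m psi) 0 0) ((pauli R k *m psi) 1 0) l).
Proof.
have e i j : cj (pauli R k i j) = pauli R k j i by rewrite -adjE pauli_herm.
rewrite /alice_amp /antipode sum_ord2 !bellE !mxE !sum_ord2 !conjE !e.
by case: l => [[|[|l]]] //= hl; ring.
Qed.

(* The outcome [k] leaves Bob with [rho] contracted, on Alice's side, with the state
   antipodal to [phi = sigma_k psi]; after the correction the fidelity is thus half
   the weight of [rho] on [phi^perp (x) phi]. *)
Lemma teleport_outcome (psi : 'cV[C]_2) rho (k : 'I_4) :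
  (psi^t* *m (pauli R k *m bell_outcome psi rho k *m (pauli R k)^t*) *m psi) 0 0
  = 2^-1 * overlap rho ((pauli R k *m psi) 0 0) ((pauli R k *m psi) 1 0).
Proof.
set W := bell_outcome _ _ _; set phi := (pauli R k *m psi).
have -> : (psi^t* *m (pauli R k *m W *m (pauli R k)^t*) *m psi) 0 0 = (phi^t* *m W *m phi) 0 0.
  congr (_ 0 0).
  have -> : phi^t* = psi^t* *m (pauli R k).
    rewrite -[in RHS]pauli_herm.
    apply/matrixP => i j; rewrite adjE !mxE rmorph_sum; apply: eq_bigr => l _ /=.
    by rewrite !mxE conjM mulrC.
  by rewrite pauli_herm !mulmxA.
rewrite qformE /W !bell_outcome_amp !sum_ord2 !alice_ampE -/phi.
rewrite -inv_sqrt2_sq !conjE /overlap !sum_ord2 /spin_amp !eqxx !(negPf (oner_neq0 _)) !conjE.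
by ring.
Qed.

(** Both factors of the product vector occur together with their conjugates, so the phase enters
    only as [(cj c * c) ^+ 2]. *)
Lemma overlap_phase rho c p q : cj c * c = 1 -> overlap rho (c * p) (c * q) = overlap rho p q.
Proof.
move=> c1; rewrite -[RHS]mul1r -[1](expr1n _ 2) -c1.
rewrite /overlap !sum_ord2 /antipode /spin_amp !eqxx !(negPf (oner_neq0 _)) !conjE !conjK.
by ring.
Qed.

Lemma mx2_mulv (a b c d : C) (psi : 'cV[C]_2) :
  ((mx2 a b c d *m psi) 0 0 = a * psi 0 0 + b * psi 1 0) *
  ((mx2 a b c d *m psi) 1 0 = c * psi 0 0 + d * psi 1 0).
Proof. by rewrite !mxE !sum_ord2 !mx2E. Qed.

(* ['i] is read as [Complex 0 1] or as [Num.imaginary] according to the scope, and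
   [pauli R 2] contains both; [im1] hides the difference, which defeats [ring]. *)
Definition im1 : C := Complex (0 : R) 1.
Lemma im1K : im1 * im1 = -1. Proof. exact: ii. Qed.
Lemma conj_im1 : cj im1 = - im1. Proof. exact: conj_i. Qed.
Lemma pauli2E : pauli R 2 = mx2 0 (- im1) im1 0. Proof. by []. Qed.
Lemma pauli1E : pauli R 1 = mx2 0 1 1 0. Proof. by []. Qed.
Lemma pauli3E : pauli R 3 = mx2 1 0 0 (- 1). Proof. by []. Qed.
Lemma pauli0E : pauli R 0 = 1%:M. Proof. by []. Qed.
Definition pauliE := (pauli0E, pauli1E, pauli2E, pauli3E).

Lemma conj0 : cj 0 = 0. Proof. exact: conjC0. Qed.
Lemma conj1 : cj 1 = 1. Proof. exact: conjC1. Qed.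

(** Kept complex, so that the identities below are polynomial in the entries of an arbitrary
    [rho]. *)
Definition corr_trace rho (k : nat) : C := \tr (rho *m (pauli R k *t pauli R k)).

Lemma overlapE rho p q : overlap rho p q =
  elt rho (0, 0) (0, 0) * (q * cj p) * (p * cj q)
    + elt rho (0, 0) (0, 1) * (q * cj p) * (q * cj q)
    - elt rho (0, 0) (1, 0) * (q * cj p) * (p * cj p)
    - elt rho (0, 0) (1, 1) * (q * cj p) * (q * cj p)
    + elt rho (0, 1) (0, 0) * (q * cj q) * (p * cj q)
    + elt rho (0, 1) (0, 1) * (q * cj q) * (q * cj q)
    - elt rho (0, 1) (1, 0) * (q * cj q) * (p * cj p)
    - elt rho (0, 1) (1, 1) * (q * cj q) * (q * cj p)
    - elt rho (1, 0) (0, 0) * (p * cj p) * (p * cj q)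
    - elt rho (1, 0) (0, 1) * (p * cj p) * (q * cj q)
    + elt rho (1, 0) (1, 0) * (p * cj p) * (p * cj p)
    + elt rho (1, 0) (1, 1) * (p * cj p) * (q * cj p)
    - elt rho (1, 1) (0, 0) * (p * cj q) * (p * cj q)
    - elt rho (1, 1) (0, 1) * (p * cj q) * (q * cj q)
    + elt rho (1, 1) (1, 0) * (p * cj q) * (p * cj p)
    + elt rho (1, 1) (1, 1) * (p * cj q) * (q * cj p).
Proof.
rewrite /overlap !sum_ord2 /antipode /spin_amp !eqxx !(negPf (oner_neq0 _)) !conjE !conjK.
by ring.
Qed.

Lemma corr_trace1 rho : corr_trace rho 1 =
  elt rho (0, 0) (1, 1) + elt rho (0, 1) (1, 0) + elt rho (1, 0) (0, 1) + elt rho (1, 1) (0, 0).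
Proof.
rewrite /corr_trace mxtrace_tensE !sum_ord2 ?pauliE !mx2E !eqxx !(negPf (oner_neq0 _)).
by ring.
Qed.

Lemma corr_trace2 rho : corr_trace rho 2 =
  - elt rho (0, 0) (1, 1) + elt rho (0, 1) (1, 0) + elt rho (1, 0) (0, 1) - elt rho (1, 1) (0, 0).
Proof.
rewrite /corr_trace mxtrace_tensE !sum_ord2 ?pauliE !mx2E !eqxx !(negPf (oner_neq0 _)).
by rewrite !(mulNr, mulrN) !im1K; ring.
Qed.

Lemma corr_trace3 rho : corr_trace rho 3 =
  elt rho (0, 0) (0, 0) - elt rho (0, 1) (0, 1) - elt rho (1, 0) (1, 0) + elt rho (1, 1) (1, 1).
Proof.
rewrite /corr_trace mxtrace_tensE !sum_ord2 ?pauliE !mx2E !eqxx !(negPf (oner_neq0 _)).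
rewrite !(mulNr, mulrN) !mulr1 !mulr0.
by ring.
Qed.

(** * Bloch components of the input *)

Lemma qform_norm (psi : 'cV[C]_2) :
  (psi^t* *m psi) 0 0 = cj (psi 0 0) * psi 0 0 + cj (psi 1 0) * psi 1 0.
Proof. by rewrite mxE sum_ord2 !adjE. Qed.

Lemma qform_pauli1 (psi : 'cV[C]_2) :
  (psi^t* *m pauli R 1 *m psi) 0 0 = cj (psi 0 0) * psi 1 0 + cj (psi 1 0) * psi 0 0.
Proof.
rewrite qformE ?pauliE !mx2E !eqxx !(negPf (oner_neq0 _)).
by ring.
Qed.

Lemma qform_pauli2 (psi : 'cV[C]_2) :
  (psi^t* *m pauli R 2 *m psi) 0 0 = im1 * (cj (psi 1 0) * psi 0 0 - cj (psi 0 0) * psi 1 0).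
Proof.
rewrite qformE ?pauliE !mx2E !eqxx !(negPf (oner_neq0 _)).
rewrite !(mulNr, mulrN) !mulr0.
by ring.
Qed.

Lemma qform_pauli3 (psi : 'cV[C]_2) :
  (psi^t* *m pauli R 3 *m psi) 0 0 = cj (psi 0 0) * psi 0 0 - cj (psi 1 0) * psi 1 0.
Proof.
rewrite qformE ?pauliE !mx2E !eqxx !(negPf (oner_neq0 _)).
rewrite !(mulNr, mulrN) !mulr1 !mulr0.
by ring.
Qed.

Lemma sum_nat4 (F : nat -> C) : \sum_(k < 4) F k = F 0%N + F 1%N + F 2%N + F 3%N.
Proof. by rewrite !big_ord_recr big_ord0 /= add0r. Qed.

Lemma sum_nat3 (F : nat -> C) : \sum_(k < 3) F k = F 0%N + F 1%N + F 2%N.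
Proof. by rewrite !big_ord_recr big_ord0 /= add0r. Qed.

(** The Bloch vector of [sigma_k psi] is that of [psi], with all components but the [k]-th negated
    when [k > 0]. Over these four sign patterns the local terms and the off-diagonal correlations
    cancel, and only the squares of the components survive. *)
Lemma teleport_sum (psi : 'cV[C]_2) rho :
  \sum_(k < 4) (psi^t* *m (pauli R k *m bell_outcome psi rho k *m (pauli R k)^t*) *m psi) 0 0
  = 2^-1 * ((\tr rho) * ((psi^t* *m psi) 0 0) ^+ 2
  - \sum_(k < 3) corr_trace rho k.+1 * ((psi^t* *m pauli R k.+1 *m psi) 0 0) ^+ 2).
Proof.
under eq_bigr do rewrite teleport_outcome.
rewrite (sum_nat4 (fun k =>
  2^-1 * overlap rho ((pauli R k *m psi) 0 0) ((pauli R k *m psi) 1 0))).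
rewrite (sum_nat3 (fun k =>
  corr_trace rho k.+1 * ((psi^t* *m pauli R k.+1 *m psi) 0 0) ^+ 2)).
rewrite -!mulrDr; congr (_ * _).
rewrite qform_norm qform_pauli1 qform_pauli2 qform_pauli3.
rewrite corr_trace1 corr_trace2 corr_trace3 mxtraceE !sum_ord2.
rewrite !pauliE mul1mx !mx2_mulv !(mul0r, mul1r, add0r, addr0).
set x := psi 0 0; set y := psi 1 0.
(* [sigma_y psi] is [im1] times the real-coefficient vector [(- y, x)], and the overlap ignores this
   phase. *)
have -> : overlap rho (- im1 * y) (im1 * x) = overlap rho (- y) x.
  by rewrite mulNr -mulrN overlap_phase // conj_im1 mulNr im1K opprK.
rewrite exprMn (expr2 im1) im1K !overlapE !mulN1r !conjN.
by ring.
Qed.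

Lemma bloch_ketE (theta phi : R) :
  (bloch_ket theta phi 0 0 = (cos (theta / 2))%:C) *
  (bloch_ket theta phi 1 0 = Complex (cos phi * sin (theta / 2)) (sin phi * sin (theta / 2))).
Proof.
split; rewrite !mxE /= ?mulr1 ?mulr0 ?addr0 ?add0r //.
by apply/eqP; rewrite eq_complex /= !mulr0 subr0 add0r !eqxx.
Qed.

Lemma corrE rho (k : 'I_3) : corr rho k k = complex.Re (corr_trace rho k.+1).
Proof. by rewrite mxE. Qed.

Lemma ReM_real (z : C) (x : R) : complex.Re (z * x%:C) = complex.Re z * x.
Proof. by case: z => u v /=; rewrite mulr0 subr0. Qed.

Lemma sin_half (x : R) : sin x = 2 * (sin (x / 2) * cos (x / 2)).
Proof. by rewrite {1}(splitr x) sinD [X in _ + X]mulrC -mulr2n mulr_natl. Qed.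

Lemma cos_half (x : R) : cos x = cos (x / 2) ^+ 2 - sin (x / 2) ^+ 2.
Proof. by rewrite {1}(splitr x) cosD -!expr2. Qed.

Lemma cjE (x y : R) : cj (Complex x y) = Complex x (- y). Proof. by []. Qed.

Lemma bloch_ket_norm (theta phi : R) :
  ((bloch_ket theta phi)^t* *m bloch_ket theta phi) 0 0 = 1.
Proof.
rewrite qform_norm !bloch_ketE conj_real_complex cjE.
apply/eqP; rewrite eq_complex /=; apply/andP; split; apply/eqP; last by ring.
rewrite -[RHS](cos2Dsin2 (theta / 2)); move: (cos (theta / 2)) (sin (theta / 2)) => c s.
rewrite -[in RHS](mul1r (s ^+ 2)) -[in RHS](cos2Dsin2 phi).
by ring.
Qed.

Lemma bloch_ket_x (theta phi : R) :
  ((bloch_ket theta phi)^t* *m pauli R 1 *m bloch_ket theta phi) 0 0 =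
  (sin theta * cos phi)%:C.
Proof.
rewrite qform_pauli1 !bloch_ketE conj_real_complex cjE (sin_half theta).
by apply/eqP; rewrite eq_complex /=; apply/andP; split; apply/eqP; ring.
Qed.

Lemma bloch_ket_y (theta phi : R) :
  ((bloch_ket theta phi)^t* *m pauli R 2 *m bloch_ket theta phi) 0 0 =
  (sin theta * sin phi)%:C.
Proof.
rewrite qform_pauli2 !bloch_ketE conj_real_complex cjE (sin_half theta).
by apply/eqP; rewrite eq_complex /=; apply/andP; split; apply/eqP; ring.
Qed.

Lemma bloch_ket_z (theta phi : R) :
  ((bloch_ket theta phi)^t* *m pauli R 3 *m bloch_ket theta phi) 0 0 = (cos theta)%:C.
Proof.
rewrite qform_pauli3 !bloch_ketE conj_real_complex cjE (cos_half theta).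
apply/eqP; rewrite eq_complex /=; apply/andP; split; apply/eqP; last by ring.
move: (cos (theta / 2)) (sin (theta / 2)) => c s.
rewrite -[in RHS](mul1r (s ^+ 2)) -[in RHS](cos2Dsin2 phi).
by ring.
Qed.

Lemma teleport_fidelity_bloch rho (theta phi : R) : \tr rho = 1 ->
  teleport_fidelity rho (bloch_ket theta phi) =
  2^-1 * (1 - (corr rho 0 0 * (sin theta * cos phi) ^+ 2
    + corr rho 1 1 * (sin theta * sin phi) ^+ 2
    + corr rho ord_max ord_max * cos theta ^+ 2)).
Proof.
move=> tr1; rewrite /teleport_fidelity teleport_sum tr1 bloch_ket_norm expr1n mulr1.
rewrite (sum_nat3 (fun k => corr_trace rho k.+1 *
  (((bloch_ket theta phi)^t* *m pauli R k.+1 *m (bloch_ket theta phi)) 0 0) ^+ 2)).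
rewrite bloch_ket_x bloch_ket_y bloch_ket_z -!rmorphXn /= !corrE /=.
have -> : (2^-1 : C) = (2^-1 : R)%:C by rewrite fmorphV rmorph_nat.
by rewrite mulrC ReM_real mulrC raddfB !raddfD /= !ReM_real.
Qed.

(** * Averages over the inputs *)

Lemma eq_input_average (f g : 'cV[C]_2 -> R) :
  (forall theta phi, f (bloch_ket theta phi) = g (bloch_ket theta phi)) ->
  input_average f = input_average g.
Proof.
move=> fg; congr (_ * _); apply: eq_Rintegral => theta _.
by apply: eq_Rintegral => phi _; rewrite fg.
Qed.

(** Each squared component of a uniform unit vector has mean [1 / 3]. *)
Lemma input_average_quad (f : 'cV[C]_2 -> R) (a b c : R) :
  (forall theta phi, f (bloch_ket theta phi) = 2^-1 * (1 - (a * (sin theta * cos phi) ^+ 2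
    + b * (sin theta * sin phi) ^+ 2 + c * cos theta ^+ 2))) ->
  input_average f = 2^-1 * (1 - (a + b + c) / 3).
Proof.
move=> fE; rewrite /input_average.
have inner (theta : R) :
    \int[lebesgue_measure]_(phi in `[0, 2 * pi]) (f (bloch_ket theta phi) * sin theta)
    = (pi * (1 - (a + b) / 2) + pi * ((a + b) / 2 - c) * cos theta ^+ 2) * sin theta.
  transitivity (\int[lebesgue_measure]_(phi in `[0, 2 * pi])
    (2^-1 * (1 - c * cos theta ^+ 2) * sin theta
     + (- 2^-1 * a * sin theta ^+ 3) * cos phi ^+ 2
     + (- 2^-1 * b * sin theta ^+ 3) * sin phi ^+ 2)).
    by apply: eq_Rintegral => phi _; rewrite fE; field.
  by rewrite Rintegral_cos2_sin2 !(exprS _ 2) sin2cos2; field.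
under eq_Rintegral do rewrite inner.
rewrite Rintegral_cos2_sin; have: (pi : R) != 0 by rewrite gt_eqF ?pi_gt0.
by move: (pi : R) => p p0; field.
Qed.

Lemma average_fidelityE rho : \tr rho = 1 ->
  average_fidelity rho =
  2^-1 * (1 - (corr rho 0 0 + corr rho 1 1 + corr rho ord_max ord_max) / 3).
Proof.
by move=> tr1; apply: input_average_quad => theta phi; rewrite teleport_fidelity_bloch.
Qed.

(** The squared Bloch components add up to 1, so the fidelity is [(1 - t) / 2] at every input. *)
Lemma fidelity_stddev_scalar rho (t : R) : \tr rho = 1 ->
  corr rho = t%:M -> fidelity_stddev rho = 0.
Proof.
move=> tr1 cE.
have e (i : 'I_3) : corr rho i i = t by rewrite cE mxE eqxx.
rewrite /fidelity_stddev.
rewrite (@eq_input_average _ (fun _ => 0)) => [|theta phi].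
  rewrite /input_average.
  under eq_Rintegral => theta _.
    under eq_Rintegral do rewrite mul0r.
    rewrite Rintegral_cst // mul0r.
    over.
  by rewrite Rintegral_cst // mul0r mulr0 sqrtr0.
rewrite teleport_fidelity_bloch // average_fidelityE // !e.
have h := sin2cos2 theta; have h' := sin2cos2 phi.
by rewrite !exprMn h h'; field.
Qed.

(** * Local unitaries and spin observables *)

Lemma adj_mul m n p (A : 'M[C]_(m, n)) (B : 'M[C]_(n, p)) :
  (A *m B)^t* = B^t* *m A^t*.
Proof. by rewrite trmx_mul map_mxM. Qed.

Lemma adj_tens m n p q (A : 'M[C]_(m, n)) (B : 'M[C]_(p, q)) :
  (A *t B)^t* = A^t* *t B^t*.
Proof. by rewrite trmx_tens map_mxT. Qed.

Lemma adjK m n (A : 'M[C]_(m, n)) : (A^t*)^t* = A.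
Proof. by apply/matrixP => i j; rewrite !adjE conjK. Qed.

Lemma unitary_adjl U : U \is unitarymx -> U^t* *m U = 1%:M.
Proof. by move=> /unitarymxP /mulmx1C. Qed.

(** Cyclicity of the trace moves the unitaries from the state onto the observables. *)
Lemma mxtrace_local_conj U V rho A B :
  \tr (local_conj U V rho *m (A *t B)) =
  \tr (rho *m ((U^t* *m A *m U) *t (V^t* *m B *m V))).
Proof.
rewrite /local_conj -!mulmxA mxtrace_mulC -!mulmxA adj_tens.
by rewrite -!tensmx_mul.
Qed.

Lemma tens_mx1 : (1%:M : 'M[C]_2) *t (1%:M : 'M[C]_2) = 1%:M.
Proof.
apply/matrixP => i j; case: (mxtens_indexP i) => i1 i2; case: (mxtens_indexP j) => j1 j2.
rewrite tensmxE !mxE (can_eq (@mxtens_indexK _ _)) xpair_eqE.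
by case: (_ == _); case: (_ == _); rewrite ?mulr0 ?mulr1 ?mul0r.
Qed.

Lemma trace_local_conj U V rho : U \is unitarymx -> V \is unitarymx ->
  \tr (local_conj U V rho) = \tr rho.
Proof.
move=> hU hV; rewrite -[local_conj U V rho]mulmx1 -tens_mx1 mxtrace_local_conj.
by rewrite !mulmx1 !unitary_adjl // tens_mx1 mulmx1.
Qed.

(** The observable [x sigma_x + y sigma_y + z sigma_z]. *)
Definition spinop (x y z : R) : 'M[C]_2 :=
  mx2 z%:C (Complex x (- y)) (Complex x y) (- z%:C).

Lemma pauli_spinop (k : 'I_3) :
  pauli R k.+1 = spinop (k == 0)%:R (k == 1)%:R (k == ord_max)%:R.
Proof.
apply/matrixP => i j; rewrite /spinop.
case: k => [[|[|[|k]]]] //= hk; rewrite !mx2E /=; case: ifP => _; case: ifP => _;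
  apply/eqP; rewrite eq_complex /= ?oppr0 ?eqxx //.
Qed.

Lemma mx2_eta H : H = mx2 (H 0 0) (H 0 1) (H 1 0) (H 1 1).
Proof.
apply/matrixP => i j; rewrite mx2E.
by case: i => [[|[|i]]] // hi; case: j => [[|[|j]]] // hj /=;
  congr (H _ _); apply: val_inj.
Qed.

(** Hermitian and traceless already force the shape [n . sigma], whose square is [|n|^2] times the
    identity. *)
Lemma spinop_of_reflection H : H^t* = H -> \tr H = 0 -> H *m H = 1%:M ->
  exists x y z, H = spinop x y z /\ x ^+ 2 + y ^+ 2 + z ^+ 2 = 1.
Proof.
move=> hH tH HH.
have h10 : H 0 1 = cj (H 1 0) by rewrite -[in LHS]hH adjE.
have h00 : H 0 0 = cj (H 0 0) by rewrite -[in LHS]hH adjE.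
have h11 : H 1 1 = - H 0 0.
  by apply/eqP; rewrite -addr_eq0 addrC -tH /mxtrace sum_ord2.
have := congr1 (fun M : 'M[C]_2 => M 0 0) HH; rewrite mxE sum_ord2 mxE eqxx.
case E0 : (H 0 0) h00 h11 => [z w] h00 h11; case E1 : (H 1 0) h10 => [x y] h10.
have w0 : w = 0.
  move: h00; rewrite cjE; case=> /eqP.
  by rewrite -subr_eq0 opprK -mulr2n mulrn_eq0 /= => /eqP.
rewrite h10 cjE => /(congr1 (@complex.Re R)) /= e.
exists x, y, z; split.
  by rewrite [H]mx2_eta E0 E1 h10 h11 w0 cjE.
by move: e; rewrite w0 => <-; ring.
Qed.

Lemma pauli_sq (k : 'I_3) : pauli R k.+1 *m pauli R k.+1 = 1%:M.
Proof.
rewrite pauli_spinop; apply/matrixP => i j; rewrite mulmx2E /spinop !mx2E !mxE.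
case: k => [[|[|[|k]]]] //= hk; case: i => [[|[|i]]] // hi; case: j => [[|[|j]]] // hj /=;
  apply/eqP; rewrite eq_complex /=; apply/andP; split; apply/eqP; ring.
Qed.

Lemma trace_pauli (k : 'I_3) : \tr (pauli R k.+1) = 0.
Proof.
by rewrite pauli_spinop /mxtrace sum_ord2 /spinop !mx2E /= subrr.
Qed.

(** Unitary conjugation preserves being Hermitian, traceless and involutive; the rotated axis is
    obtained without building the rotation. *)
Lemma conj_pauli_spinop U (k : 'I_3) : U \is unitarymx ->
  exists x y z, U^t* *m pauli R k.+1 *m U = spinop x y z /\ x ^+ 2 + y ^+ 2 + z ^+ 2 = 1.
Proof.
move=> hU; have hU' : U *m U^t* = 1%:M by apply/unitarymxP.
apply: spinop_of_reflection.
- by rewrite !adj_mul adjK pauli_herm mulmxA.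
- by rewrite mxtrace_mulC mulmxA hU' mul1mx trace_pauli.
- rewrite -!mulmxA (mulmxA U) hU' mul1mx (mulmxA (pauli R _)) pauli_sq mul1mx.
  exact: unitary_adjl.
Qed.

Lemma pauli_unitary (k : 'I_3) : pauli R k.+1 \is unitarymx.
Proof. by apply/unitarymxP; rewrite pauli_herm pauli_sq. Qed.

(** Half-turn about the y axis, which makes the correlation matrix [diag (t, - t, t)] equal to
    [- t I]. *)
Lemma conj_pauli2_spinop (x y z : R) :
  (pauli R 2)^t* *m spinop x y z *m pauli R 2 = spinop (- x) y (- z).
Proof.
rewrite pauli_herm (pauli_spinop 1); apply/matrixP => i j; rewrite !mulmx2E /spinop !mx2E.
case: i => [[|[|i]]] // hi; case: j => [[|[|j]]] // hj /=;
  apply/eqP; rewrite eq_complex /=; apply/andP; split; apply/eqP; ring.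
Qed.

(* [rho] has the correlations of [t |Phi+><Phi+|]: its matrix is [diag (t, - t, t)]. *)
Definition phi_correlated (t : R) rho := forall x y z x' y' z' : R,
  \tr (rho *m (spinop x y z *t spinop x' y' z')) = (t * (x * x' - y * y' + z * z'))%:C.

Definition phi_corr t (k : 'I_3) : R := if k == 1 then - t else t.

Lemma corr_phi t rho : phi_correlated t rho -> corr rho = diag_mx (\row_k phi_corr t k).
Proof.
move=> hb; apply/matrixP => i j; rewrite !mxE !pauli_spinop hb /= /phi_corr.
case: i => [[|[|[|i]]]] // hi; case: j => [[|[|[|j]]]] // hj /=;
  rewrite ?mulr0n ?mulr1n; ring.
Qed.

Lemma corr_phi_flip t rho : phi_correlated t rho ->
  corr (local_conj (pauli R 2) 1%:M rho) = (- t)%:M.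
Proof.
move=> hb; apply/matrixP => i j; rewrite [LHS]mxE mxtrace_local_conj !pauli_spinop.
rewrite conj_pauli2_spinop mulmx1.
have -> : (1%:M : 'M[C]_2)^t* = 1%:M by rewrite trmx1 map_mx1.
rewrite mul1mx hb !mxE /=.
case: i => [[|[|[|i]]]] // hi; case: j => [[|[|[|j]]]] // hj /=;
  rewrite ?mulr0n ?mulr1n; ring.
Qed.

(** * Maximal fidelity and deviation of states with correlations [diag (t, - t, t)] *)

Lemma one_unitary : (1%:M : 'M[C]_2) \is unitarymx.
Proof. by apply/unitarymxP; rewrite trmx1 map_mx1 mulmx1. Qed.

Lemma max_average_fidelity_phi t rho : 0 <= t -> \tr rho = 1 -> phi_correlated t rho ->
  max_average_fidelity rho = 2^-1 * (1 + t).
Proof.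
move=> t0 tr1 hb.
rewrite /max_average_fidelity; set A := [set x | _].
(* The supremum is a maximum: the flip by [sigma_y] attains the value, and [- t] bounds each
   diagonal correlation from below. *)
have [y Ay [ub yE]] : exists2 y, A y & ubound A y /\ y = 2^-1 * (1 + t).
  exists (2^-1 * (1 + t)).
    exists (pauli R 2), 1%:M; split; [exact: (pauli_unitary 1)|exact: one_unitary|].
    rewrite average_fidelityE; last by rewrite trace_local_conj ?one_unitary ?(pauli_unitary 1).
    by rewrite (corr_phi_flip hb) !mxE !eqxx !mulr1n; field.
  split=> // x [U [V [hU hV ->]]].
  rewrite average_fidelityE ?trace_local_conj // ler_pM2l ?invr_gt0 //.
  have bound (k : 'I_3) : - t <= corr (local_conj U V rho) k k.
    rewrite mxE mxtrace_local_conj.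
    have [x1 [x2 [x3 [-> e1]]]] := conj_pauli_spinop k hU.
    have [y1 [y2 [y3 [-> e2]]]] := conj_pauli_spinop k hV.
    rewrite hb /=.
    (* Cauchy-Schwarz for the unit vectors x and (- y1, y2, - y3) *)
    have : 0 <= (x1 + y1) ^+ 2 + (x2 - y2) ^+ 2 + (x3 + y3) ^+ 2.
      by rewrite !addr_ge0 ?sqr_ge0.
    have -> : (x1 + y1) ^+ 2 + (x2 - y2) ^+ 2 + (x3 + y3) ^+ 2 =
      (x1 ^+ 2 + x2 ^+ 2 + x3 ^+ 2) + (y1 ^+ 2 + y2 ^+ 2 + y3 ^+ 2) +
      2 * (x1 * y1 - x2 * y2 + x3 * y3) by ring.
    rewrite e1 e2; set s := (_ + x3 * y3) => hs.
    have : 0 <= t * (s + 1) by apply: mulr_ge0 => //; lra.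
    by rewrite mulrDr mulr1; lra.
  by have := bound 0; have := bound 1; have := bound ord_max; lra.
rewrite -yE; apply/eqP; rewrite eq_le; apply/andP; split.
  by apply: ge_sup => //; exists y.
by apply: ub_le_sup => //; exists y.
Qed.

Lemma char_poly_scalar (u : R) : char_poly (u%:M : 'M[R]_3) = ('X - u%:P) ^+ 3.
Proof.
by rewrite /char_poly /char_poly_mx map_scalar_mx -raddfB /= det_scalar.
Qed.

(** The signs disappear in [T^T *m T], which is [t ^+ 2] times the identity; each [s k ^+ 2] is thus
    a root of [('X - t ^+ 2) ^+ 3]. *)
Lemma singular_values_phi_corr t (s : 'I_3 -> R) : 0 <= t ->
  singular_values (diag_mx (\row_k phi_corr t k)) s <-> forall k, s k = t.
Proof.
move=> t0; rewrite /singular_values.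
have -> : (diag_mx (\row_k phi_corr t k))^T *m diag_mx (\row_k phi_corr t k) = (t ^+ 2)%:M.
  rewrite tr_diag_mx mulmx_diag -diag_const_mx; congr diag_mx.
  by apply/rowP => k; rewrite !mxE /phi_corr; case: ifP => _; rewrite ?mulrNN -expr2.
rewrite char_poly_scalar; split=> [[s0 e] k|e].
  apply/eqP; rewrite -(@eqrXn2 _ 2%N) //.
  have : root (('X - (t ^+ 2)%:P) ^+ 3) (s k ^+ 2).
    by rewrite e (bigD1 k) //= rootM root_XsubC eqxx.
  by rewrite root_exp_XsubC.
split=> [k|]; first by rewrite e.
by rewrite (eq_bigr (fun=> 'X - (t ^+ 2)%:P)) ?prodr_const ?card_ord // => k _; rewrite e.
Qed.

Lemma det_phi_corr t : \det (diag_mx (\row_k phi_corr t k)) = - t ^+ 3.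
Proof.
by rewrite det_diag !big_ord_recl big_ord0 !mxE /phi_corr /=; ring.
Qed.

Lemma fidelity_deviation_phi t rho : 0 <= t -> \tr rho = 1 -> phi_correlated t rho ->
  fidelity_deviation rho = 0.
Proof.
move=> t0 tr1 hb; rewrite /fidelity_deviation /canonical_form.
have detle : \det (diag_mx (\row_k phi_corr t k)) <= 0 by rewrite det_phi_corr oppr_le0 exprn_ge0.
(* [xget] returns its default [rho] when the set is empty, so a canonical form is exhibited before
   anything is said about the chosen one. *)
have [] : is_canonical_form rho (xget rho [set rhoC | is_canonical_form rho rhoC]).
  apply: (@xgetPex _ rho (fun rhoC => is_canonical_form rho rhoC)).
  exists (local_conj (pauli R 2) 1%:M rho); split.
    exists (pauli R 2), 1%:M; split; [exact: (pauli_unitary 1)|exact: one_unitary|by []].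
  (* All signs are [-1] because the determinant [- t ^+ 3] is not positive. *)
  exists (fun=> t), (fun=> -1); rewrite (corr_phi hb); split.
  - exact/singular_values_phi_corr.
  - by split=> //; rewrite ltNge detle.
  - rewrite (corr_phi_flip hb) -diag_const_mx; congr diag_mx.
    by apply/rowP => k; rewrite !mxE mulN1r.
set rhoC := xget _ _ => -[U [V [hU hV rhoCE]]] [s [l []]].
rewrite (corr_phi hb) => /(singular_values_phi_corr _ t0) sE [/(_ detle) lE _] cE.
apply: (@fidelity_stddev_scalar _ (- t)); first by rewrite rhoCE trace_local_conj.
rewrite cE -diag_const_mx; congr diag_mx.
by apply/rowP => k; rewrite !mxE lE sE mulN1r.
Qed.

(** * The damped state *)

Lemma PsiE (a : R) (i j : 'I_2) : Psi a (mxtens_index (i, j)) 0 =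
  if i == j then (if i == 0 then Num.sqrt a else Num.sqrt (1 - a))%:C else 0.
Proof.
rewrite /Psi mxE [X in X + _]mxE [X in _ + X]mxE !ket2E.
by case: i => [[|[|i]]] // hi; case: j => [[|[|j]]] // hj /=;
  rewrite !(mulr0, mulr1, mul0r, addr0, add0r).
Qed.

Lemma concurrence_Psi (a : R) : 0 <= a -> a <= 1 ->
  concurrence (Psi a) = 2 * Num.sqrt (a * (1 - a)).
Proof.
move=> a0 a1; rewrite /concurrence pauliE mxE sum_tens !sum_ord2.
rewrite ![map_mx _ _ _ _]mxE !PsiE /= !conj0 !mulr0 add0r addr0.
rewrite !mxE !sum_tens !sum_ord2 !adjE !PsiE /= !tensmxE !mx2E /= sqrtrM //.
(* The modulus has become the square root of the sum of the squared real and imaginary parts. *)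
rewrite (_ : _ + _ = (2 * (Num.sqrt a * Num.sqrt (1 - a))) ^+ 2); last by ring.
by rewrite sqrtr_sqr ger0_norm // !mulr_ge0 ?sqrtr_ge0.
Qed.

Lemma id_tensE (L : 'M[C]_2 -> 'M[C]_2) rho (i j k l : 'I_2) :
  id_tens L rho (mxtens_index (i, k)) (mxtens_index (j, l)) =
  L (\matrix_(k, l) elt rho (i, k) (j, l)) k l.
Proof.
rewrite /id_tens summxE (bigD1 i) //= [X in _ + X]big1 ?addr0; last first.
  move=> i' /negPf ne; rewrite summxE big1 // => j' _.
  by rewrite tensmxE mxE eq_sym ne mul0r.
rewrite summxE (bigD1 j) //= [X in _ + X]big1 ?addr0; last first.
  move=> j' /negPf ne.
  by rewrite tensmxE mxE eqxx eq_sym ne mul0r.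
by rewrite tensmxE mxE !eqxx mul1r.
Qed.

(** Amplitude damping with [|0>] as the decaying level. *)
Lemma kraus_nuE (g : R) (chi : 'M[C]_2) : 0 <= g -> g <= 1 ->
  kraus_map (Kraus_nu g) chi =
  mx2 ((1 - g)%:C * chi 0 0) ((Num.sqrt (1 - g))%:C * chi 0 1)
      ((Num.sqrt (1 - g))%:C * chi 1 0) (chi 1 1 + g%:C * chi 0 0).
Proof.
move=> g0 g1.
have e1 : (1 - g)%:C = (Num.sqrt (1 - g))%:C * (Num.sqrt (1 - g))%:C.
  by rewrite -rmorphM -expr2 sqr_sqrtr // subr_ge0.
have e2 : g%:C = (Num.sqrt g)%:C * (Num.sqrt g)%:C.
  by rewrite -rmorphM -expr2 sqr_sqrtr.
rewrite e1 e2 /kraus_map; apply/matrixP => i j; rewrite summxE sum_ord2.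
rewrite !mulmx2E !adjE /Kraus_nu !eqxx !(negPf (oner_neq0 _)) !mx2E.
by case: i => [[|[|i]]] // hi; case: j => [[|[|j]]] // hj /=;
  rewrite ?conj0 ?conj1 ?conj_real_complex; ring.
Qed.

Lemma kraus_nu_complete (g : R) : 0 <= g -> g <= 1 ->
  \sum_i (Kraus_nu g i)^t* *m Kraus_nu g i = 1%:M.
Proof.
move=> g0 g1; apply/matrixP => i j; rewrite summxE sum_ord2.
have e1 : (Num.sqrt (1 - g))%:C * (Num.sqrt (1 - g))%:C = (1 - g)%:C.
  by rewrite -rmorphM -expr2 sqr_sqrtr // subr_ge0.
have e2 : (Num.sqrt g)%:C * (Num.sqrt g)%:C = g%:C.
  by rewrite -rmorphM -expr2 sqr_sqrtr.
rewrite !mulmx2E !adjE /Kraus_nu !eqxx !(negPf (oner_neq0 _)) !mx2E mxE.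
by case: i => [[|[|i]]] // hi; case: j => [[|[|j]]] // hj /=;
  rewrite ?conj0 ?conj1 ?conj_real_complex ?e1 ?e2 ?rmorphB ?rmorph1; ring.
Qed.

(** The damped state has only the populations of [|00>], [|01>], [|11>] and the coherence between
    [|00>] and [|11>]; each contributes one term. *)
Lemma damped_traceE (a g : R) (A B : 'M[C]_2) : 0 <= a -> a <= 1 -> 0 <= g -> g <= 1 ->
  \tr (id_tens (kraus_map (Kraus_nu g)) (projector (Psi a)) *m (A *t B)) =
  (a * (1 - g))%:C * A 0 0 * B 0 0 + (a * g)%:C * A 0 0 * B 1 1 + (1 - a)%:C * A 1 1 * B 1 1
  + (Num.sqrt (a * (1 - a)) * Num.sqrt (1 - g))%:C * (A 0 1 * B 0 1 + A 1 0 * B 1 0).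
Proof.
move=> a0 a1 g0 g1.
have e1 : a%:C = (Num.sqrt a)%:C * (Num.sqrt a)%:C.
  by rewrite -rmorphM -expr2 sqr_sqrtr.
have e2 : (1 - a)%:C = (Num.sqrt (1 - a))%:C * (Num.sqrt (1 - a))%:C.
  by rewrite -rmorphM -expr2 sqr_sqrtr // subr_ge0.
have P (i j k l : 'I_2) : projector (Psi a) (mxtens_index (i, k)) (mxtens_index (j, l)) =
    Psi a (mxtens_index (i, k)) 0 * cj (Psi a (mxtens_index (j, l)) 0).
  by rewrite mxE big_ord1 adjE.
rewrite mxtrace_tensE !sum_ord2 !id_tensE !kraus_nuE // !mx2E /=.
rewrite ![(\matrix_(_, _) _) _ _]mxE !P !PsiE /= !conj0 !conj_real_complex.
rewrite sqrtrM // !rmorphM /= e1 e2; ring.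
Qed.

Lemma trace_damped (a g : R) : 0 <= a -> a <= 1 -> 0 <= g -> g <= 1 ->
  \tr (id_tens (kraus_map (Kraus_nu g)) (projector (Psi a))) = 1.
Proof.
move=> a0 a1 g0 g1; rewrite -[X in \tr X]mulmx1 -tens_mx1 damped_traceE // !mxE /=.
by apply/eqP; rewrite eq_complex /=; apply/andP; split; apply/eqP; ring.
Qed.

Lemma phi_correlated_damped (a g t : R) : 0 <= a -> a <= 1 -> 0 <= g -> g <= 1 ->
  t = 1 - 2 * a * g -> 2 * (Num.sqrt (a * (1 - a)) * Num.sqrt (1 - g)) = t ->
  phi_correlated t (id_tens (kraus_map (Kraus_nu g)) (projector (Psi a))).
Proof.
move=> a0 a1 g0 g1 tE et x y z x' y' z'.
rewrite damped_traceE // /spinop !mx2E /=.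
move: (Num.sqrt _ * _) et => e et.
apply/eqP; rewrite eq_complex /=; apply/andP; split; apply/eqP; last by ring.
(* The transverse [t] is to be replaced by twice the coherence, the longitudinal one by
   [1 - 2 * a * g]. *)
have -> : t * (x * x' - y * y' + z * z') = t * (x * x' - y * y') + t * (z * z') by ring.
by rewrite -{1}et tE; ring.
Qed.

(** The identity has its first diagonal entry lowered to [1 - g]. *)
Lemma kraus_nu_non_unital (g : R) : 0 < g -> g <= 1 ->
  non_unital (kraus_map (Kraus_nu g)).
Proof.
move=> g0 g1; rewrite /non_unital kraus_nuE // ?ltW //.
move=> /(congr1 (fun M : 'M[R[i]]_2 => M 0 0)).
rewrite mx2E !mxE /= mulr1 => -[] /eqP.
by rewrite subr_eq addrC -subr_eq subrr eq_sym gt_eqF.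
Qed.
End Qubits.

(** * Real algebra of the damping parameter and of the threshold *)

(** With [1 + w = 2 a], equal transverse and longitudinal correlations mean
    [(1 - w^2) (1 - g) = (1 - u)^2] for [u = (1 + w) g], that is [u^2 - (1 + w) u + w^2 = 0]. The
    discriminant is [q^2], and [g] comes from the smaller root. *)
Lemma damping_balance (R : realType) (w q : R) : 0 < w -> w < 1 -> 0 <= q ->
  q ^+ 2 = (1 - w) * (1 + 3 * w) ->
  let g := (1 + w - q) / (2 + 2 * w) in
  [/\ 0 < g, g <= 1, (1 - w + q) / 2 = 1 - (1 + w) * g &
   (1 - w ^+ 2) * (1 - g) = ((1 - w + q) / 2) ^+ 2].
Proof.
move=> w0 w1 q0 q2 g.
have w2 : 2 + 2 * w != 0 by rewrite gt_eqF //; lra.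
(* The difference [(1 + w)^2 - q^2] is [4 w^2]. *)
have qw : q < 1 + w.
  by rewrite ltNge; apply/negP => h; have : (1 + w) ^+ 2 <= q ^+ 2; [nra | rewrite q2; nra].
split.
- by rewrite /g divr_gt0 //; lra.
- by rewrite /g ler_pdivrMr ?mul1r; lra.
- by rewrite /g; field.
- have -> : ((1 - w + q) / 2) ^+ 2 = ((1 - w) ^+ 2 + 2 * (1 - w) * q + q ^+ 2) / 4 by field.
  by rewrite q2 /g; field.
Qed.

(** For [F = (3 - w + q) / 4] the conclusion is [F > 2/3]. As [q^2 - (w - 1/3)^2 = 4 (1/3 - (w -
    1/3)^2)], it follows from [w < (1 + sqrt 3) / 3], which is the threshold on [p] rewritten
    through [p^2 = 1 - w^2]. *)
Lemma threshold_bound (R : realType) (p w q : R) : 0 < p -> 0 < w -> w < 1 -> 0 <= q ->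
  p ^+ 2 = 1 - w ^+ 2 -> q ^+ 2 = (1 - w) * (1 + 3 * w) ->
  Num.sqrt (2 / 3 * (4 + Num.sqrt 3) * (1 - 1 / 6 * (4 + Num.sqrt 3))) < p ->
  w - 1 / 3 < q.
Proof.
move=> p0 w0 w1 q0 p2 q2 hlt.
have r0 : 0 <= Num.sqrt 3 :> R by rewrite sqrtr_ge0.
have r2 : Num.sqrt 3 ^+ 2 = 3 :> R by rewrite sqr_sqrtr.
move: (Num.sqrt 3) r0 r2 hlt => r r0 r2 hlt.
have {}hlt : (5 - 2 * r) / 9 < p ^+ 2.
  rewrite ltNge; apply/negP => h; move: hlt; rewrite ltNge => /negP; apply.
  rewrite -[p](ger0_norm (ltW p0)) -sqrtr_sqr; apply: ler_wsqrtr; move: h.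
  have -> : 2 / 3 * (4 + r) * (1 - 1 / 6 * (4 + r)) = (8 - 2 * r - r ^+ 2) / 9 by field.
  by rewrite r2; lra.
(* [1 - (5 - 2 r) / 9] is the square of [(1 + r) / 3], since [r ^+ 2 = 3]. *)
have hw : w < (1 + r) / 3.
  rewrite ltNge; apply/negP => h.
  have : ((1 + r) / 3) ^+ 2 <= w ^+ 2 by rewrite lerXn2r ?nnegrE //; lra.
  have -> : ((1 + r) / 3) ^+ 2 = (1 + 2 * r + r ^+ 2) / 9 by field.
  by rewrite r2; lra.
rewrite ltNge; apply/negP => h.
have h1 : q ^+ 2 <= (w - 1 / 3) ^+ 2 by rewrite lerXn2r ?nnegrE //; lra.
have h2 : (w - 1 / 3) ^+ 2 < (r / 3) ^+ 2 by rewrite ltrXn2r ?nnegrE //; lra.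
have e : (r / 3) ^+ 2 = 1 / 3 by rewrite expr_div_n r2; field.
by move: h1 h2; rewrite q2 e; nra.
Qed.

Unset Implicit Arguments.

Theorem mainTheorem9 (R : realType) (p1 a : R)
    (hp0 : 0 < p1) (hp1 : p1 < 1) (ha0 : 1 / 2 < a) (ha1 : a < 1)
    (hC : concurrence (Psi a) = p1) :
  let C := concurrence (Psi a) in
  let rhof := id_tens (Lambda_nu p1) (projector (Psi a)) in
  [/\ C = 2 * Num.sqrt (a * (1 - a)),
      qubit_channel (Lambda_nu p1) /\ non_unital (Lambda_nu p1),
      max_average_fidelity rhof =
        (3 - Num.sqrt (1 - C ^+ 2)
           + Num.sqrt (3 * C ^+ 2 - 2 + 2 * Num.sqrt (1 - C ^+ 2))) / 4,
      fidelity_deviation rhof = 0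
    & Num.sqrt (2 / 3 * (4 + Num.sqrt 3) * (1 - 1 / 6 * (4 + Num.sqrt 3))) < C ->
      2 / 3 < max_average_fidelity rhof /\ useful_for_UQT rhof].
Proof.
move=> C rhof.
have [a0 a1] : 0 <= a /\ a <= 1 by split; lra.
have CE : C = 2 * Num.sqrt (a * (1 - a)) by apply: concurrence_Psi.
have p1E : p1 = 2 * Num.sqrt (a * (1 - a)) by rewrite -CE -hC.
pose w := 2 * a - 1.
have [w0 w1] : 0 < w /\ w < 1 by rewrite /w; split; lra.
have p2 : p1 ^+ 2 = 1 - w ^+ 2.
  rewrite p1E exprMn sqr_sqrtr; first by rewrite /w; ring.
  by rewrite mulr_ge0 // subr_ge0.
have sw : Num.sqrt (1 - p1 ^+ 2) = w.
  by rewrite p2 opprB addrC subrK sqrtr_sqr ger0_norm // ltW.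
pose q := Num.sqrt (3 * p1 ^+ 2 - 2 + 2 * w).
have q0 : 0 <= q by exact: sqrtr_ge0.
have q2 : q ^+ 2 = (1 - w) * (1 + 3 * w).
  have e : 3 * p1 ^+ 2 - 2 + 2 * w = (1 - w) * (1 + 3 * w) by rewrite p2; ring.
  by rewrite /q e sqr_sqrtr // mulr_ge0 //; lra.
have gE : gamma p1 = (1 + w - q) / (2 + 2 * w) by rewrite /gamma sw.
have [g0 g1 tE t2] := damping_balance w0 w1 q0 q2.
rewrite -gE in g0 g1 tE t2.
pose t := (1 - w + q) / 2.
have t0 : 0 <= t by rewrite /t; lra.
have tr1 : \tr rhof = 1 by apply: trace_damped => //; exact: ltW.
have bal : phi_correlated t rhof.
  apply: phi_correlated_damped => //; first exact: ltW.
    by rewrite /t tE /w; ring.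
  (* Both sides are nonnegative, so their squares are compared. *)
  rewrite mulrA -p1E -[LHS]ger0_norm ?mulr_ge0 ?sqrtr_ge0 ?ltW // -sqrtr_sqr.
  by rewrite exprMn sqr_sqrtr ?subr_ge0 // p2 t2 sqrtr_sqr ger0_norm.
have Fmax : max_average_fidelity rhof = 2^-1 * (1 + t) by exact: max_average_fidelity_phi.
have dev0 : fidelity_deviation rhof = 0 by exact: (fidelity_deviation_phi t0).
split=> //.
- split; last exact: kraus_nu_non_unital.
  by exists 2%N, (Kraus_nu (gamma p1)); split=> //; apply: kraus_nu_complete => //; exact: ltW.
- by rewrite Fmax /C hC sw -/q /t; field.
- rewrite /C hC => /(threshold_bound hp0 w0 w1 q0 p2 q2) hq.
  have F23 : 2 / 3 < max_average_fidelity rhof by rewrite Fmax /t; lra.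
  by split.
Qed.
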